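(* Let $G$ be a torsion abelian group. If $ns(G)=0$, then $|G|\leq\mathfrak c$, where $\mathfrak c$ is the cardinality of the continuum.
   Context: $\mathbb N=\{0,1,2,\dots\}$ and $\mathbb N_+=\mathbb N\setminus\{0\}$. Let $\phi$ be an endomorphism of an abelian group $G$. A string of $\phi$ is a sequence $S=\{x_n\}_{n\in\mathbb N}$ of pairwise distinct elements of $G$ such that $\phi(x_n)=x_{n-1}$ for every $n\in\mathbb N_+$. A string is singular if $\phi^j(x_0)=\phi^k(x_0)$ for some $j\neq k$ in $\mathbb N$, and non-singular otherwise. Define $ns(\phi)$ as the supremum of the cardinalities $|\mathcal F|$, where $\mathcal F$ ranges over the families of pairwise disjoint non-singular strings of $\phi$; if this supremum is infinite it is set equal to the symbol $\infty$. For an abelian group $G$, $ns(G)=\sup\{ns(\phi):\phi\in\mathrm{End}(G)\}$. *)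

(* Defs.v *)
From mathcomp Require Import all_boot all_order all_algebra.
From mathcomp Require Import all_classical all_reals all_analysis.

Set Implicit Arguments.
Unset Strict Implicit.
Unset Printing Implicit Defensive.

Import GRing.Theory.
Local Open Scope classical_set_scope.
Local Open Scope ring_scope.

Definition torsion (G : zmodType) : Prop :=
  forall x : G, exists2 n : nat, (0 < n)%N & x *+ n = 0.

Definition is_string (G : zmodType) (phi : {additive G -> G}) (x : nat -> G)
    : Prop :=
  injective x /\ forall n : nat, (0 < n)%N -> phi (x n) = x n.-1.

Definition singular (G : zmodType) (phi : {additive G -> G}) (x : nat -> G)
    : Prop :=
  exists j k : nat, j <> k /\ iter j phi (x 0%N) = iter k phi (x 0%N).

(* Disjointness of strings is disjointness of their sets of terms. *)
Definition ns_family (G : zmodType) (phi : {additive G -> G})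
    (F : set (nat -> G)) : Prop :=
  (forall x, F x -> is_string phi x /\ ~ singular phi x) /\
  trivIset F (fun x : nat -> G => range x).

(* [counting F] is the number of elements of [F] when [F] is finite and [+oo]
   otherwise, so all infinite cardinalities are identified with [+oo]; the
   real type [R] only serves as a carrier for the values in [nat] and [+oo]. *)
Definition ns_end (R : realType) (G : zmodType) (phi : {additive G -> G})
    : \bar R :=
  ereal_sup [set counting F | F in ns_family phi].

Definition ns (R : realType) (G : zmodType) : \bar R :=
  ereal_sup (range (@ns_end R G)).

(* Main.v *)
From HB Require Import structures.
Require Import Defs.
From mathcomp Require Import all_boot all_order all_algebra.
From mathcomp Require Import all_classical all_reals all_analysis.
From mathcomp Require Import lra.

(** Suppose that no endomorphism of [G] has a non-singular string.  Two
    countability facts follow, both from one construction of strings.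

    Let [T] be a subgroup of [G] which is injective over the integers modulo [N]
    and meets the multiples of [N] in [0]; the value [N = 0] covers divisible
    subgroups.  If, for some prime [p], the elements of [T] killed by [p] are
    uncountable, then they contain an infinite independent sequence indexed by
    the integers.  Shifting this sequence is a homomorphism from its span to
    [T], and injectivity extends it to an endomorphism of [G], by Baer's argument
    ([extend_hom]); the shifted sequence is a non-singular string
    ([nonsingular_string_of_uncountable_socle]).

    The maximal divisible subgroup [D] satisfies the hypotheses with [N = 0], so
    [D[p]] is countable for each [p], and [D], being torsion, is countable
    ([countable_divisible_part]).

    For a prime power [q = p ^ k.+1], take a maximal subgroup [B] which is a pure
    direct sum of cyclic groups of order [q].  It satisfies the hypotheses with
    [N = q], hence is countable, and by maximality it captures
    [G[q]] up to [pG] and [G[p ^ k]].  Thus each [G / pG], and then each [G / nG]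
    with [n > 0], is countable ([countable_mod_multiples]).

    Finally, expanding an element successively modulo [1], [2], [3] and so on, as
    a number in the factorial base, produces a sequence of digits from countable
    sets.  It determines the element modulo [D], because two elements with the
    same digits differ by the beginning of an infinite chain of divisions.  So
    [G] embeds into the sequences of natural numbers ([embeds_in_sequences]),
    and these embed into the reals. *)

Set Implicit Arguments.
Unset Strict Implicit.
Unset Printing Implicit Defensive.

Import Order.TTheory GRing.Theory Num.Theory.
Import numFieldTopology.Exports.
Local Open Scope classical_set_scope.
Local Open Scope ring_scope.

(** * Subgroups and Zorn's lemma *)

Definition subgroup (G : zmodType) (A : set G) : Prop :=
  A 0 /\ forall x y, A x -> A y -> A (x - y).

Section Subgroups.
Variables (G : zmodType) (A : set G).
Hypothesis sgA : subgroup A.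

Lemma subgroupN x : A x -> A (- x).
Proof. by move=> Ax; rewrite -sub0r; apply: sgA.2 => //; exact: sgA.1. Qed.

Lemma subgroupD x y : A x -> A y -> A (x + y).
Proof.
by move=> Ax Ay; rewrite -(opprK y); apply: sgA.2 => //; exact: subgroupN.
Qed.

Lemma subgroupMn x n : A x -> A (x *+ n).
Proof.
move=> Ax; elim: n => [|n IHn]; first by rewrite mulr0n; exact: sgA.1.
by rewrite mulrS; exact: subgroupD.
Qed.

Lemma subgroupMz x (j : int) : A x -> A (x *~ j).
Proof.
move=> Ax; case: j => n; first exact: subgroupMn.
by rewrite NegzE mulrNz; apply: subgroupN; exact: subgroupMn.
Qed.

Lemma subgroup_sum n (x : nat -> G) :
  (forall i, (i < n)%N -> A (x i)) -> A (\sum_(i < n) x i).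
Proof.
move=> Ax; elim/big_ind: _ => [|y z|i _]; first exact: sgA.1.
- exact: subgroupD.
- exact: Ax.
Qed.

End Subgroups.

Definition adjoin (G : zmodType) (A : set G) (g : G) : set G :=
  [set x | exists a (j : int), A a /\ x = a + g *~ j].

Section Adjoin.
Variables (G : zmodType) (A : set G) (g : G).
Hypothesis sgA : subgroup A.

Lemma subgroup_adjoin : subgroup (adjoin A g).
Proof.
split; first by exists 0, 0; split; [exact: sgA.1 | rewrite mulr0z addr0].
move=> _ _ [a [j [Aa ->]]] [b [k [Ab ->]]].
exists (a - b), (j - k); split; first exact: sgA.2.
by rewrite mulrzBr opprD addrACA.
Qed.

Lemma sub_adjoin : A `<=` adjoin A g.
Proof. by move=> a Aa; exists a, 0; rewrite mulr0z addr0. Qed.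

Lemma mem_adjoin : adjoin A g g.
Proof. by exists 0, 1; split; [exact: sgA.1 | rewrite add0r]. Qed.

End Adjoin.

Lemma subgroup_bigcup_chain (G : zmodType) (F : set (set G)) :
  F !=set0 -> total_on F subset -> (forall X, F X -> subgroup X) ->
  subgroup (\bigcup_(X in F) X).
Proof.
move=> [X0 FX0] totF sgF; split; first by exists X0 => //; case: (sgF _ FX0).
move=> x y [X FX Xx] [Y FY Yy].
case: (totF X Y FX FY) => [XY|YX].
- by exists Y => //; apply: (sgF _ FY).2 => //; exact: XY.
- by exists X => //; apply: (sgF _ FX).2 => //; exact: YX.
Qed.

(** The form in which Zorn's lemma is used: the subgroup axioms pass to unions
    of chains only, whereas the side conditions [P] of interest are
    elementwise, hence pass to arbitrary nonempty unions. *)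
Lemma maximal_subgroup (G : zmodType) (P : set (set G)) (A0 : set G) :
  (forall F : set (set G), F !=set0 -> F `<=` P -> P (\bigcup_(X in F) X)) ->
  subgroup A0 -> P A0 ->
  exists A, [/\ subgroup A, P A, A0 `<=` A &
    forall B, subgroup B -> P B -> A `<=` B -> B `<=` A].
Proof.
move=> PU sgA0 PA0.
pose Q := [set X : set G | subgroup (X `|` A0) /\ P (X `|` A0)].
have [F FQ totF|A [[sgA PA] Amax]] := @Zorn_bigcup G Q.
  have [->|/set0P[X0 FX0]] := eqVneq F set0.
    by rewrite /Q/= bigcup_set0 set0U.
  pose F1 := [set X `|` A0 | X in F].
  have F1neq0 : F1 !=set0 by exists (X0 `|` A0), X0.
  have UF : \bigcup_(X in F1) X = (\bigcup_(X in F) X) `|` A0.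
    rewrite bigcup_image; apply/seteqP.
    split=> [x [X FX [Xx|A0x]]|x [[X FX Xx]|A0x]].
    - by left; exists X.
    - by right.
    - by exists X => //; left.
    - by exists X0 => //; right.
  rewrite /Q/= -UF; split.
    apply: subgroup_bigcup_chain => //; last first.
      by move=> _ [X FX <-]; case: (FQ _ FX).
    move=> _ _ [X FX <-] [Y FY <-].
    by case: (totF X Y FX FY) => XY; [left|right]; apply: setUSS.
  by apply: PU => // _ [X FX <-]; case: (FQ _ FX).
exists (A `|` A0); split=> // B sgB PB AB x Bx.
apply: contrapT => nAx; apply: (Amax B); last first.
  rewrite /Q/= (_ : B `|` A0 = B) //.
  by apply/setUidPl => y A0y; apply: AB; right.
split; first by move=> y Ay; apply: AB; left.
by move=> BA; apply: nAx; left; exact: BA.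
Qed.

(** * Extension of homomorphisms *)

(** Partial homomorphisms from [G] to [H] are encoded by their graphs, which
    are subgroups of [G * H]; such a subgroup is the graph of a function as soon
    as it meets [0 * H] trivially. *)
Definition functional_graph (G H : zmodType) (A : set (G * H)) : Prop :=
  forall t, A (0, t) -> t = 0.

(** When [T] is killed by [N], this is Baer's criterion for [T] to be injective
    over the integers modulo [N]: a map from the ideal [m] to [T] extends to the
    whole ring.  For [N = 0] the factor [d] is [0], the equation [t *+ d = 0]
    is void, and [T] is divisible. *)
Definition multiples_injective (H : zmodType) (T : set H) (N : nat) : Prop :=
  forall m d t, (0 < m)%N -> N = (m * d)%N -> T t -> t *+ d = 0 ->
    exists2 s, T s & s *+ m = t.

Section Extension.
Variables (G H : zmodType) (T : set H) (N : nat).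
Hypotheses (sgT : subgroup T) (injT : multiples_injective T N).

(** Partial homomorphisms into [T] that kill the multiples of [N]: these are the
    ones that come from [G] modulo its multiples of [N], where Baer's criterion
    applies. *)
Definition partial_hom (A : set (G * H)) : Prop :=
  [/\ functional_graph A, forall x t, A (x, t) -> T t &
      forall g, A (g *+ N, 0)].

Lemma pair_mulrz (x : G) (t : H) (j : int) : (x, t) *~ j = (x *~ j, t *~ j).
Proof.
have pairMn n : (x, t) *+ n = (x *+ n, t *+ n).
  by elim: n => [|n IHn]; rewrite ?mulr0n// !mulrS IHn.
by case: j => n; rewrite ?NegzE ?mulrNz -?pmulrn pairMn.
Qed.

Lemma graph_inj (A : set (G * H)) x t u :
  subgroup A -> functional_graph A -> A (x, t) -> A (x, u) -> t = u.
Proof.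
move=> sgA fA At Au; apply/eqP; rewrite -subr_eq0; apply/eqP/fA.
by rewrite -(subrr x); exact: sgA.2 At Au.
Qed.

(** The step of Baer's criterion: the integers [j] with [g *~ j] in the domain
    form an ideal containing [N].  If [m > 0] generates it, then the value at
    [g *+ m] is killed by [N / m], hence is [s *+ m] for some [s], a consistent
    value at [g]; if the ideal is zero, any value is consistent. *)
Lemma one_step_value (A : set (G * H)) (g : G) :
  subgroup A -> partial_hom A ->
  exists2 s, T s & forall j y, A (g *~ j, y) -> y = s *~ j.
Proof.
move=> sgA [fA AT AN].
have AMz x t j : A (x, t) -> A (x *~ j, t *~ j).
  by rewrite -pair_mulrz; exact: subgroupMz.
pose I m := (0 < m)%N /\ exists t, A (g *+ m, t).
have [exI|noI] := pselect (exists m, `[< I m >]); last first.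
  exists 0; first exact: sgT.1.
  move=> j y Ajy; have [j0|jn0] := eqVneq j 0.
    by rewrite mul0rz; apply: fA; rewrite -(mulr0z g) -j0.
  exfalso; apply: noI; exists `|j|%N; apply/asboolP; split.
    by rewrite absz_gt0.
  exists (y *~ sgz j); rewrite pmulrn abszEsg mulrC mulrzA.
  exact: AMz.
case: (ex_minnP exI) => m /asboolP[m0 [u Au]] mmin.
have mdvd (j : int) y : A (g *~ j, y) -> (m %| j)%Z.
  move=> Ajy; apply: contraT => ndvd.
  have : A (g *~ (j %% m)%Z, y - u *~ (j %/ m)%Z).
    rewrite (_ : (j %% m)%Z = j - m%:Z * (j %/ m)%Z) ?mulrzBr ?mulrzA.
      exact: (sgA.2 (_, _) (_, _) Ajy (AMz _ _ _ Au)).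
    by rewrite {2}(divz_eq j m) mulrC addrC addKr.
  have r0 : (0 <= (j %% m)%Z) by rewrite modz_ge0// -lt0n.
  have rm : (`|(j %% m)%Z| < m)%N.
    by rewrite -ltz_nat gez0_abs// ltz_pmod.
  rewrite -(gez0_abs r0) => Ar.
  suff : (m <= `|(j %% m)%Z|)%N by rewrite leqNgt rm.
  apply: mmin; apply/asboolP; split; last by exists (y - u *~ (j %/ m)%Z).
  by rewrite absz_gt0; apply: contra ndvd => /eqP/dvdz_mod0P.
have /dvdnP[d Nd] : (m %| N)%N by have := mdvd N 0 (AN g).
have [s Ts su] : exists2 s, T s & s *+ m = u.
  apply: (injT m0 _ (AT _ _ Au)); first by rewrite mulnC; exact: Nd.
  apply: (graph_inj (x := g *+ N) sgA fA) => //.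
  by rewrite Nd mulnC mulrnA; have := AMz _ _ d Au.
exists s => // j y Ajy; have /dvdzP[q jq] := mdvd _ _ Ajy.
apply: (graph_inj sgA fA Ajy).
by rewrite jq mulrC !mulrzA -!pmulrn su; exact: AMz.
Qed.

(** A maximal extension is everywhere defined, since otherwise one more value
    could be added. *)
Lemma extend_hom (A : set (G * H)) :
  subgroup A -> partial_hom A ->
  exists f : {additive G -> H}, forall x t, A (x, t) -> f x = t.
Proof.
move=> sgA pA.
have [|B [sgB pB AB Bmax]] := maximal_subgroup _ sgA pA.
  move=> F [X0 FX0] FP; split.
  - by move=> t [X /FP[fX _ _]]; exact: fX.
  - by move=> x t [X /FP[_ XT _]]; exact: XT.
  - by move=> g; exists X0 => //; case: (FP _ FX0).
have totB g : exists t, B (g, t).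
  have [s Ts sval] := one_step_value g sgB pB.
  exists s; apply: (Bmax (adjoin B (g, s))).
  - exact: subgroup_adjoin.
  - case: pB => fB BT BN; split.
    + move=> t [[x y] [j [Bxy]]]; rewrite pair_mulrz => -[/esym x0 ->].
      have xE : - x = g *~ j by apply/eqP; rewrite eq_sym -addr_eq0 addrC x0.
      have /sval <- : B (g *~ j, - y).
        by rewrite -xE; exact: subgroupN Bxy.
      by rewrite subrr.
    + move=> x t [[x' y] [j [Bxy]]]; rewrite pair_mulrz => -[_ ->].
      by apply: subgroupD; [|exact: BT Bxy|exact: subgroupMz].
    + by move=> h; apply: sub_adjoin; exact: BN.
  - exact: sub_adjoin.
  - exact: mem_adjoin.
have [f fB] := choice totB.
have f_is_zmod_morphism : zmod_morphism f.
  move=> x y; apply: (graph_inj (x := x - y) sgB); first by case: pB.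
  - exact: fB.
  - exact: sgB.2 (fB x) (fB y).
pose f_additive := GRing.isZmodMorphism.Build G H f f_is_zmod_morphism.
pose F : {additive G -> H} := HB.pack f f_additive.
exists F => x t /AB Bxt.
by apply: (graph_inj sgB _ (fB x) Bxt); case: pB.
Qed.

End Extension.

(** * Independent sequences and shifts *)

Definition torsion_part (G : zmodType) (A : set G) (n : nat) : set G :=
  [set x | A x /\ x *+ n = 0].

Lemma torsion_mulrz (G : zmodType) (x : G) (n : nat) (j : int) :
  x *+ n = 0 -> (n %| j)%Z -> x *~ j = 0.
Proof. by move=> xn0 /dvdzP[q ->]; rewrite mulrC mulrzA -pmulrn xn0 mul0rz. Qed.

(** For elements of prime order this is linear independence over the prime
    field; stating it for a sequence with respect to its earlier terms makes it
    suitable for a construction by recursion. *)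
Definition independent (G : zmodType) (e : nat -> G) : Prop :=
  forall n (c : nat -> int), e n <> \sum_(i < n) e i *~ c i.

(** Finitely many elements generate a countable subgroup, so an uncountable set
    always contains a next term. *)
Lemma independent_sequence (G : zmodType) (V : set G) :
  ~ countable V -> exists e, (forall n, V (e n)) /\ independent e.
Proof.
move=> uncV.
pose comb (s : seq G) (c : seq int) := \sum_(i < size s) s`_i *~ c`_i.
have /choice[pick pickP] s : exists x, V x /\ ~ range (comb s) x.
  apply: contrapT => noV; apply: uncV.
  apply: (@sub_countable _ _ _ [set: seq int]); last exact: countableP.
  apply: card_le_trans (card_image_le (comb s) _).
  apply: subset_card_le => x Vx; apply: contrapT => nx.
  by apply: noV; exists x.
pose L n := iter n (fun s => rcons s (pick s)) [::].
have sizeL n : size (L n) = n by elim: n => //= n IHn; rewrite size_rcons IHn.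
have nthL n i : (i < n)%N -> (L n)`_i = pick (L i).
  elim: n => //= n IHn; rewrite ltnS nth_rcons sizeL leq_eqVlt.
  by case/orP => [/eqP ->|lt_in]; rewrite ?ltnn ?eqxx// lt_in IHn.
exists (fun n => pick (L n)); split=> [n|n c]; first by case: (pickP (L n)).
move=> pickE; case: (pickP (L n)) => _; apply; exists (mkseq c n) => //.
rewrite pickE /comb sizeL; apply: eq_bigr => i _.
by rewrite nthL// nth_mkseq.
Qed.

Lemma independent_inj (G : zmodType) (e : nat -> G) :
  independent e -> injective e.
Proof.
move=> ind_e.
suff lt_neq i j : (i < j)%N -> e j <> e i.
  by move=> i j eij; case: (ltngtP i j) => // /lt_neq; rewrite eij.
move=> lt_ij eji; apply: (ind_e j (fun k => (k == i)%:Z)).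
rewrite (bigD1 (Ordinal lt_ij))//= eqxx mulr1z big1 ?addr0// => k.
by rewrite -val_eqE => /= /negPf ->.
Qed.

Section Reindexing.
Variables (G : zmodType) (T : set G) (N p : nat) (e : nat -> G).
Hypotheses (sgT : subgroup T) (injT : multiples_injective T N).
Hypothesis T_multiples : forall g, T (g *+ N) -> g *+ N = 0.
Hypotheses (p_prime : prime p) (eT : forall n, torsion_part T p (e n)).
Hypothesis ind_e : independent e.

Lemma independent_coef n (c : nat -> int) :
  \sum_(i < n) e i *~ c i = 0 -> forall i, (i < n)%N -> (p %| c i)%Z.
Proof.
elim: n => // n IHn; rewrite big_ord_recr/= => comb0.
have ep0 : e n *+ p = 0 by case: (eT n).
have pcn : (p %| c n)%Z.
  apply: contraT => npc; exfalso.
  have cop : coprimez (c n) p.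
    rewrite coprimez_sym /coprimez; move: npc; rewrite dvdzE /gcdz/=.
    by rewrite -[_ == _]/(coprime p `|c n|) prime_coprime.
  have [[u v] /= bez] := coprimezP _ _ cop.
  apply: (ind_e (n := n) (c := fun i => - (c i * u))).
  rewrite -[LHS]mulr1z -bez mulrzDr [v * _]mulrC (mulrzA _ p%:Z) -pmulrn ep0.
  rewrite mul0rz addr0 mulrC mulrzA.
  move/eqP: comb0; rewrite addrC addr_eq0 => /eqP ->.
  rewrite mulNrz mulrz_suml -sumrN; apply: eq_bigr => i _.
  by rewrite mulrNz mulrzA.
move: comb0; rewrite (torsion_mulrz ep0 pcn) addr0 => /IHn pc i.
by rewrite ltnS leq_eqVlt => /orP[/eqP ->//|/pc].
Qed.

Lemma sum_coef_widen (x : nat -> G) (c : nat -> int) m n : (m <= n)%N ->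
  \sum_(i < m) x i *~ c i = \sum_(i < n) x i *~ (if (i < m)%N then c i else 0).
Proof.
move=> le_mn; rewrite (big_ord_widen n (fun i => x i *~ c i) le_mn) big_mkcond.
by apply: eq_bigr => i _; case: ifP.
Qed.

(** By independence, [e i |-> e (s i)] is well defined on the span of [e], for
    any [s].  It is set to [0] on the multiples of [N], which meet the span
    trivially, and then extends by injectivity of [T]. *)
Lemma extend_reindexing (s : nat -> nat) :
  exists f : {additive G -> G}, forall i, f (e i) = e (s i).
Proof.
pose A : set (G * G) := [set z | exists n (c : nat -> int) g,
  z = (\sum_(i < n) e i *~ c i + g *+ N, \sum_(i < n) e (s i) *~ c i)].
have eTT i : T (e i) by case: (eT i).
have [||f fA] := @extend_hom G G T N sgT injT A.
- split; first by exists 0%N, (fun=> 0), 0; rewrite !big_ord0 mul0rn addr0.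
  move=> _ _ [m [c [g ->]]] [n [d [h ->]]].
  exists (maxn m n), (fun i => (if (i < m)%N then c i else 0)
                             - (if (i < n)%N then d i else 0)), (g - h).
  rewrite (sum_coef_widen _ _ (leq_maxl m n)).
  rewrite (sum_coef_widen _ _ (leq_maxr m n)).
  rewrite (sum_coef_widen (fun i => e (s i)) _ (leq_maxl m n)).
  rewrite (sum_coef_widen (fun i => e (s i)) _ (leq_maxr m n)).
  congr (_, _) => /=; last first.
    by rewrite -sumrB; apply: eq_bigr => i _; rewrite mulrzBr.
  rewrite mulrnBl opprD addrACA; congr (_ + _).
  by rewrite -sumrB; apply: eq_bigr => i _; rewrite mulrzBr.
- split.
  + move=> t [n [c [g [/esym/eqP]]]]; rewrite addr_eq0 => /eqP combE ->.
    have g0 : g *+ N = 0.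
      apply: T_multiples; rewrite -(opprK (g *+ N)) -combE.
      apply: subgroupN => //.
      apply: (subgroup_sum sgT (x := fun i => e i *~ c i)).
      by move=> i _; exact: subgroupMz.
    rewrite g0 oppr0 in combE.
    apply: big1 => i _; apply: (@torsion_mulrz _ _ p).
      by case: (eT (s i)).
    exact: independent_coef combE _ _.
  + move=> x _ [n [c [g [_ ->]]]].
    apply: (subgroup_sum sgT (x := fun i => e (s i) *~ c i)) => i _.
    exact: subgroupMz.
  + by move=> g; exists 0%N, (fun=> 0), g; rewrite !big_ord0 add0r.
exists f => i; apply: fA; exists i.+1, (fun k => (k == i)%:Z), 0.
rewrite mul0rn addr0 !big_ord_recr/= eqxx !mulr1z !big1 ?add0r// => k _.
  by rewrite (ltn_eqF (ltn_ord k)).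
by rewrite (ltn_eqF (ltn_ord k)).
Qed.

End Reindexing.

Definition has_nonsingular_string (G : zmodType) : Prop :=
  exists (phi : {additive G -> G}) x, is_string phi x /\ ~ singular phi x.

(** The endomorphism moves an independent sequence along the two-sided path
    [... -> 4 -> 2 -> 0 -> 1 -> 3 -> 5 -> ...] of indices: the even terms form a
    string, and the odd terms keep the forward orbit of [e 0] infinite. *)
Lemma nonsingular_string_of_uncountable_socle (G : zmodType) (T : set G) N p :
  subgroup T -> multiples_injective T N ->
  (forall g, T (g *+ N) -> g *+ N = 0) ->
  prime p -> ~ countable (torsion_part T p) -> has_nonsingular_string G.
Proof.
move=> sgT injT TN p_prime /independent_sequence[e [eT ind_e]].
pose s i := if i is i'.+1 then if odd i then i.+2 else i'.-1 else 1%N.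
have [f fe] := extend_reindexing sgT injT TN p_prime eT ind_e s.
have e_inj := independent_inj ind_e.
exists f, (fun n => e n.*2); split.
  split=> [m n /e_inj|[//|n] _]; first by move/double_inj.
  by rewrite fe /= odd_double.
move=> [j [k [jk]]].
have iterE i : iter i.+1 f (e 0%N) = e i.*2.+1.
  elim: i => [|i IHi]; first by rewrite /= fe.
  by rewrite iterS IHi fe /= odd_double.
case: j k jk => [|j] [|k] jk //; rewrite ?iterE.
- by move/e_inj.
- by move/e_inj.
- by move/e_inj => [/double_inj jkE]; apply: jk; rewrite jkE.
Qed.

(** * Countability of torsion subgroups and of the divisible part *)

Lemma countable_fibers (X Y : Type) (A : set X) (f : X -> Y) :
  countable (f @` A) ->
  (forall x, A x -> countable (A `&` [set x' | f x' = f x])) ->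
  countable A.
Proof.
move=> cfA cfib.
pose fiber y := A `&` [set x | f x = y].
apply: (@sub_countable _ _ _ (\bigcup_(y in f @` A) fiber y)).
  by apply: subset_card_le => x Ax; exists (f x); [exists x|].
by apply: bigcup_countable => // _ [x Ax <-]; exact: cfib.
Qed.

Lemma countable_sub (X : Type) (A B : set X) :
  A `<=` B -> countable B -> countable A.
Proof. by move=> /subset_card_le; exact: sub_countable. Qed.

Lemma countable_image (X Y : Type) (A : set X) (f : X -> Y) :
  countable A -> countable (f @` A).
Proof. exact/sub_countable/card_image_le. Qed.

(** Reduces a countability statement about all positive [n] to prime [n]. *)
Lemma multiplicative_ind (P : nat -> Prop) :
  P 1%N -> (forall p, prime p -> P p) ->
  (forall a b, P a -> P b -> P (a * b)%N) ->
  forall n, (0 < n)%N -> P n.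
Proof.
move=> P1 Pp PM; elim/ltn_ind => n IHn n0.
have [n1|n1] := leqP n 1.
  by rewrite (_ : n = 1%N)//; apply/eqP; rewrite eqn_leq n1.
rewrite -(divnK (pdiv_dvd n)); apply: PM; last exact/Pp/pdiv_prime.
by apply: IHn; rewrite ?ltn_Pdiv ?divn_gt0 ?pdiv_leq ?pdiv_gt0 ?prime_gt1
                       ?pdiv_prime.
Qed.

Lemma torsion_part1 (G : zmodType) (T : set G) : countable (torsion_part T 1).
Proof. by apply: countable_sub (countable1 0) => x [_]; rewrite mulr1n. Qed.

(** Multiplication by [b] maps [T[ab]] to [T[a]], and its fibers are translates
    of [T[b]]. *)
Lemma torsion_partM (G : zmodType) (T : set G) a b : subgroup T ->
  countable (torsion_part T a) -> countable (torsion_part T b) ->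
  countable (torsion_part T (a * b)).
Proof.
move=> sgT ca cb; apply: (@countable_fibers _ _ _ (fun x => x *+ b)).
  apply: countable_sub ca => _ [x [Tx xab0] <-]; split; first exact: subgroupMn.
  by rewrite -mulrnA mulnC.
move=> x [Tx _]; apply: countable_sub (countable_image (fun y => x + y) cb).
move=> y [[Ty _] yx]; exists (y - x); last by rewrite addrC subrK.
by split; [exact: sgT.2|rewrite mulrnBl yx subrr].
Qed.

Definition divisible_set (G : zmodType) (X : set G) : Prop :=
  forall x m, X x -> (0 < m)%N -> exists2 y, X y & y *+ m = x.

(** A union of divisible subsets, not only of subgroups, so that divisibility of
    the union is immediate; the sum of two divisible sets being divisible, it is
    nevertheless a subgroup. *)
Definition divisible_part (G : zmodType) : set G :=
  [set x | exists2 X, divisible_set X & X x].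
Arguments divisible_part G : clear implicits.

Lemma divisible_part_divisible (G : zmodType) :
  divisible_set (divisible_part G).
Proof.
move=> x m [X divX Xx] /(divX x)[//|y Xy yx].
by exists y => //; exists X.
Qed.

Lemma subgroup_divisible_part (G : zmodType) : subgroup (divisible_part G).
Proof.
split.
  exists [set 0] => // x m -> _.
  by exists 0; rewrite ?mul0rn.
move=> x y [X divX Xx] [Y divY Yy].
exists [set z | exists u v, [/\ X u, Y v & z = u - v]]; last first.
  by exists x, y.
move=> _ m [u [v [Xu Yv ->]]] m0.
have [u' Xu' <-] := divX _ _ Xu m0; have [v' Yv' <-] := divY _ _ Yv m0.
by exists (u' - v'); [exists u', v'|rewrite mulrnBl].
Qed.

(** A divisible group is injective, which is the case [N = 0] of the
    construction of strings. *)
Lemma countable_divisible_part (G : zmodType) :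
  torsion G -> ~ has_nonsingular_string G -> countable (divisible_part G).
Proof.
move=> torsG noS; set D := divisible_part G.
have sgD : subgroup D by exact: subgroup_divisible_part.
have cDn n : (0 < n)%N -> countable (torsion_part D n).
  move: n; apply: multiplicative_ind; first exact: torsion_part1.
    move=> p p_prime; apply: contrapT => unc; apply: noS.
    apply: (@nonsingular_string_of_uncountable_socle _ D 0 p) => //.
    by move=> m d t m0 _ Dt _; exact: divisible_part_divisible.
  by move=> a b ca cb; exact: torsion_partM.
apply: (@countable_sub _ _ (\bigcup_n torsion_part D n.+1)).
  by move=> x Dx; have [[//|n] _ xn0] := torsG x; exists n.
by apply: bigcup_countable => // n _; exact: cDn.
Qed.

(** * Countability of the quotients modulo multiples *)

Definition countable_mod (G : zmodType) (A : set G) (n : nat) : Prop :=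
  exists2 C : set G, countable C &
    forall x, A x -> exists c h, C c /\ x = c + h *+ n.

Section BoundedPure.
Variables (G : zmodType) (p k : nat).
Hypothesis p_prime : prime p.
Local Notation q := (p ^ k.+1)%N.

(** These conditions say that [B] is a direct sum of cyclic groups of order [q],
    and that it stays so modulo the multiples of [q]: it is a pure, hence direct,
    summand of [G].  Maximal such [B] replace the homogeneous components of a
    basic subgroup. *)
Definition homogeneous_pure (B : set G) : Prop :=
  [/\ forall x, B x -> x *+ q = 0,
      forall x, B x -> x *+ p = 0 -> exists2 b, B b & b *+ (p ^ k) = x &
      forall g, B (g *+ q) -> g *+ q = 0].

(** Every element killed by [p ^ i] is a multiple of [p ^ (k.+1 - i)]: for
    [i = 1] this is a hypothesis on [B], and the general case follows by
    subtracting a suitable multiple and descending on [i]. *)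
Lemma homogeneous_pure_injective (B : set G) :
  subgroup B -> homogeneous_pure B -> multiples_injective B q.
Proof.
move=> sgB [_ socB _].
have divB i t : (i <= k.+1)%N -> B t -> t *+ (p ^ i) = 0 ->
    exists2 s, B s & s *+ (p ^ (k.+1 - i)) = t.
  elim: i t => [|i IHi] t le_ik Bt.
    by rewrite mulr1n => ->; exists 0; [exact: sgB.1|rewrite mul0rn].
  rewrite expnSr mulrnA => /(socB _ (subgroupMn sgB _ Bt))[b Bb bE].
  have [|||s Bs sE] := IHi (t - b *+ (p ^ (k - i))); first exact: ltnW.
  - by apply: sgB.2 => //; exact: subgroupMn.
  - by rewrite mulrnBl -mulrnA -expnD subnK// bE subrr.
  exists (s *+ p + b); first by apply: subgroupD => //; exact: subgroupMn.
  by rewrite subSS mulrnDl -mulrnA -expnS -subSn// sE subrK.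
move=> m d t m0 qmd Bt td0.
have /(dvdn_pfactor _ _ p_prime)[i le_ik dE] : (d %| q)%N.
  by rewrite qmd dvdn_mull.
have [|s Bs <-] := divB i t le_ik Bt; first by rewrite -dE.
exists s => //; congr (_ *+ _); apply/eqP.
rewrite -(eqn_pmul2r (m := d)); last by rewrite dE expn_gt0 prime_gt0.
by rewrite -qmd dE -expnD subnK.
Qed.

(** The order of [x] modulo [B] and the multiples of [q] divides [q]; being a
    power of [p] that does not divide [p ^ k], it is [q]. *)
Lemma order_mod_pure (B : set G) (x : G) : subgroup B -> x *+ q = 0 ->
  ~ (exists b g, B b /\ x *+ (p ^ k) = b + g *+ q) ->
  forall (j : int) b g, B b -> x *~ j = b + g *+ q -> (q %| j)%Z.
Proof.
move=> sgB xq0 nx j b g Bb xj.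
have [u [v bez]] := Bezoutz j q.
have /(dvdn_pfactor _ _ p_prime)[i le_ik dE] : (`|gcdz j q| %| q)%N.
  by have := dvdz_gcdr j q; rewrite dvdzE absz_nat.
have dE' : gcdz j q = (p ^ i)%N by rewrite -dE gez0_abs.
have [lt_ki|le_ik'] := ltnP k i.
  apply: dvdz_trans (dvdz_gcdl j q); rewrite dE'.
  by rewrite (_ : i = k.+1)//; apply/eqP; rewrite eqn_leq le_ik.
exfalso; apply: nx.
exists (b *~ u *+ (p ^ (k - i))), (g *~ u *+ (p ^ (k - i))).
split; first by apply: subgroupMn => //; exact: subgroupMz.
have xd : x *+ (p ^ i) = b *~ u + g *~ u *+ q.
  rewrite pmulrn -dE' -bez mulrzDr [v * _]mulrC [in LHS](mulrzA _ q%:Z).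
  rewrite -pmulrn xq0 mul0rz addr0 mulrC mulrzA xj mulrzDl; congr (_ + _).
  by rewrite !pmulrn -!mulrzA mulrC.
rewrite -[X in x *+ (p ^ X)](subnK le_ik') addnC expnD mulrnA xd mulrnDl.
by rewrite -!mulrnA [(q * _)%N]mulnC.
Qed.

(** An [x] violating the last clause could be adjoined to [B]: by
    [order_mod_pure] the sum of [B] and the cyclic group of [x] is direct, also
    modulo the multiples of [q]. *)
Lemma maximal_homogeneous_pure : exists B : set G,
  [/\ subgroup B, homogeneous_pure B &
      forall x, x *+ q = 0 -> exists b g, B b /\ x *+ (p ^ k) = b + g *+ q].
Proof.
have [|||B [sgB pB _ Bmax]] := @maximal_subgroup G homogeneous_pure [set 0].
- move=> F [X0 FX0] FP; split.
  + by move=> x [X /FP[XP _ _]]; exact: XP.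
  + move=> x [X FX Xx] xp0; case: (FP _ FX) => _ /(_ x Xx xp0)[b Xb bE] _.
    by exists b => //; exists X.
  + by move=> g [X /FP[_ _ XP]]; exact: XP.
- by split=> // x y -> ->; rewrite subr0.
- split=> [x ->|x -> _|//]; first by rewrite mul0rn.
  by exists 0; rewrite ?mul0rn.
exists B; split=> // x xq0; apply: contrapT => nx.
have ordx := order_mod_pure sgB xq0 nx.
have Bx : B x.
  apply: (Bmax (adjoin B x));
    [exact: subgroup_adjoin| |exact: sub_adjoin|exact: mem_adjoin].
  case: pB => Bq Bsoc Bpure; split.
  - move=> _ [b [j [Bb ->]]]; rewrite mulrnDl Bq// add0r.
    by rewrite pmulrn -mulrzA mulrC mulrzA -pmulrn xq0 mul0rz.
  - move=> _ [b [j [Bb ->]]]; rewrite mulrnDl => bxp0.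
    have : (q %| j * p)%Z.
      apply: (ordx _ (- (b *+ p)) 0).
        by apply: subgroupN => //; exact: subgroupMn.
      rewrite mul0rn addr0 mulrzA -pmulrn; apply/eqP.
      by rewrite eq_sym -subr_eq0 -opprD oppr_eq0 bxp0.
    rewrite expnSr PoszM dvdz_mul2r; last by rewrite eqz_nat -lt0n prime_gt0.
    move=> /dvdzP[j' jE].
    have bp0 : b *+ p = 0.
      move: bxp0; rewrite jE (pmulrn (_ *~ _)) -mulrzA -mulrA -PoszM -expnSr.
      by rewrite mulrC mulrzA -pmulrn xq0 mul0rz addr0.
    have [b' Bb' b'E] := Bsoc _ Bb bp0.
    exists (b' + x *~ j'); first by exists b', j'.
    by rewrite mulrnDl b'E jE [in RHS]mulrzA.
  - move=> g [b [j [Bb gE]]].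
    have : (q %| j)%Z.
      apply: (ordx _ (- b) g); first exact: subgroupN.
      by rewrite gE addKr.
    move=> /(torsion_mulrz xq0) xj0; move: gE; rewrite xj0 addr0 => gE.
    by apply: Bpure; rewrite gE.
apply: nx; exists (x *+ (p ^ k)), 0; rewrite mul0rn addr0; split=> //.
exact: subgroupMn.
Qed.

End BoundedPure.

(** Induction on [k]: the maximal subgroup [B] for [q = p ^ k.+1] is countable,
    since an uncountable socle would yield a string, and each [x] killed by [q]
    differs from an element of [B] and a multiple of [p] by an element killed by
    [p ^ k].  Indeed [x *+ (p ^ k) = b + g *+ q] forces [b *+ p] to be a multiple
    of [p * q] in [B], so [b *+ p = 0] and [b] is in turn [b' *+ (p ^ k)]. *)
Lemma countable_mod_prime_power (G : zmodType) p k : prime p ->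
  ~ has_nonsingular_string G ->
  countable_mod (torsion_part [set: G] (p ^ k)) p.
Proof.
move=> p_prime noS; elim: k => [|k [C cC CP]].
  exists [set 0]; first exact: countable1.
  by move=> x [_]; rewrite mulr1n => ->; exists 0, 0; rewrite mul0rn addr0.
have [B [sgB pB Bmax]] := @maximal_homogeneous_pure G p k p_prime.
have [Bq Bsoc Bpure] := pB.
have cB : countable B.
  have cBp : countable (torsion_part B p).
    apply: contrapT => unc; apply: noS.
    exact: (nonsingular_string_of_uncountable_socle sgB
              (homogeneous_pure_injective p_prime sgB pB) Bpure p_prime unc).
  have cBpi i : countable (torsion_part B (p ^ i)).
    elim: i => [|i IHi]; first exact: torsion_part1.
    by rewrite expnS; exact: torsion_partM.
  by apply: countable_sub (cBpi k.+1) => x Bx; split=> //; exact: Bq.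
exists ((fun z => z.1 + z.2) @` (B `*` C)).
  by apply: countable_image; exact: countableX.
move=> x [_ xq0]; have [b [g [Bb bE]]] := Bmax x xq0.
have bp0 : b *+ p = 0.
  have bpE : b *+ p = (- g *+ p) *+ (p ^ k.+1).
    apply/eqP; rewrite !mulNrn -subr_eq0 opprK -!mulrnA [(p * _)%N]mulnC.
    by rewrite mulrnA -mulrnDl -bE -mulrnA -expnSr xq0.
  by rewrite bpE; apply: Bpure; rewrite -bpE; exact: subgroupMn.
have [b' Bb' b'E] := Bsoc _ Bb bp0.
have [|c [h [Cc cE]]] := CP (x - b' - g *+ p).
  by split=> //; rewrite !mulrnBl bE b'E -mulrnA -expnS addrAC addrK subrr.
exists (b' + c), (g + h); split; first by exists (b', c).
by rewrite mulrnDl addrACA -cE -(addrA x) -opprD addrC subrK.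
Qed.

(** For prime [p], torsion elements of order prime to [p] are multiples of [p],
    so the quotient modulo [p] is the union of the images of the subgroups
    killed by [p ^ k]. *)
Lemma countable_mod_multiples (G : zmodType) n :
  torsion G -> ~ has_nonsingular_string G -> (0 < n)%N ->
  countable_mod [set: G] n.
Proof.
move=> torsG noS; move: n; apply: multiplicative_ind.
- exists [set 0]; first exact: countable1.
  by move=> x _; exists 0, x; rewrite add0r mulr1n.
- move=> p p_prime.
  have /choice[C CP] k : exists C : set G, countable C /\
      forall x, x *+ (p ^ k) = 0 -> exists c h, C c /\ x = c + h *+ p.
    have [C cC CP] := countable_mod_prime_power k p_prime noS.
    by exists C; split=> // x xk; exact: CP.
  exists (\bigcup_k C k).
    by apply: bigcup_countable => // k _; case: (CP k).
  move=> g _; have [n n0 gn0] := torsG g.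
  have [m pm nE] := pfactor_coprime p_prime n0.
  (* the exponent [(logn p n).+1] rather than [logn p n] guarantees a multiple
     of [p] even when [p] does not divide [n] *)
  have /coprimezP[[u v] /= bez] : coprimez m (p ^ (logn p n).+1)%N.
    rewrite /coprimez /gcdz/= -[_ == _]/(coprime m (p ^ (logn p n).+1)).
    by rewrite coprime_sym coprimeXl.
  have [|c [h [Cc gE]]] := (CP (logn p n)).2 (g *~ u *+ m).
    rewrite -mulrnA -nE pmulrn -mulrzA mulrC mulrzA -pmulrn gn0.
    by rewrite mul0rz.
  exists c, (h + g *~ v *+ (p ^ logn p n)); split; first by exists (logn p n).
  rewrite mulrnDl -mulrnA -expnSr addrA -gE !pmulrn -!mulrzA -mulrzDr.
  by rewrite bez mulr1z.
- move=> a b [C cC CP] [D cD DP].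
  exists ((fun z => z.1 + z.2 *+ a) @` (C `*` D)).
    by apply: countable_image; exact: countableX.
  move=> x _.
  have [c [h [Cc ->]]] := CP x I; have [d [i [Dd ->]]] := DP h I.
  exists (c + d *+ a), i; split; first by exists (c, d).
  by rewrite mulrnDl -mulrnA addrA [(b * a)%N]mulnC.
Qed.

(** * Counting the group *)

Section Continuum.
Variable R : realType.
Implicit Types b c : nat -> bool.

Let partial b n : R := \sum_(i < n) (b i)%:R * (4^-1) ^+ i.
(* [4 / 3 * 4 ^- n] is the sum of the tail with all digits equal to 1 *)
Let upper b n : R := partial b n + 4 / 3 * (4^-1) ^+ n.

Let partialS b n : partial b n.+1 = partial b n + (b n)%:R * (4^-1) ^+ n.
Proof. by rewrite /partial big_ord_recr. Qed.

Let pow_gt0 n : 0 < (4^-1 : R) ^+ n.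
Proof. by rewrite exprn_gt0// invr_gt0. Qed.

Let partial_le_upper b m n : partial b m <= upper b n.
Proof.
have partial_mono k : partial b m <= partial b (m + k).
  elim: k => [|k IHk]; first by rewrite addn0.
  by rewrite addnS partialS ler_wpDr// mulr_ge0// ltW.
have upper_mono k : upper b (n + k) <= upper b n.
  elim: k => [|k IHk]; first by rewrite addn0.
  apply: le_trans IHk; rewrite addnS /upper partialS exprS.
  by have := pow_gt0 (n + k); case: (b _) => /=; lra.
apply: le_trans (partial_mono n) _.
rewrite addnC; apply: le_trans (upper_mono m).
by rewrite /upper lerDl mulr_ge0// ltW.
Qed.

Definition quaternary b : R := sup (range (partial b)).

Let quaternary_ge b n : partial b n <= quaternary b.
Proof.
by apply: ub_le_sup; [exists (upper b 0) => _ [m _ <-]|exists n].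
Qed.

Let quaternary_le b n : quaternary b <= upper b n.
Proof. by apply: ge_sup => [|_ [m _ <-]//]; exists (partial b 0), 0%N. Qed.

(** Digits 0 and 1 in base 4 are read off from the sum without ambiguity: after
    position [n] the digits contribute at most [1/3 * 4 ^- n], less than a digit
    1 at position [n]. *)
Lemma quaternary_inj : injective quaternary.
Proof.
suff first_diff b c n : (forall i, (i < n)%N -> b i = c i) -> b n -> ~~ c n ->
    quaternary b <> quaternary c.
  move=> b c bc; apply/funext; elim/ltn_ind => n IHn.
  case bn : (b n); case cn : (c n) => //; exfalso.
  - by apply: (first_diff b c n) => //; rewrite ?bn ?cn.
  - by apply: (first_diff c b n) => //; rewrite ?bn ?cn// => i /IHn.
move=> eq_bc bn cn qbc.
have := quaternary_ge b n.+1; have := quaternary_le c n.+1.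
rewrite /upper !partialS bn (negPf cn) qbc /= exprS.
have -> : partial b n = partial c n by apply: eq_bigr => i _; rewrite eq_bc.
by have := pow_gt0 n; lra.
Qed.

Lemma sequences_le_continuum : ([set: nat -> nat] #<= [set: R])%card.
Proof.
pose graph (s : nat -> nat) (n : nat) : bool :=
  if unpickle n is Some (i, j) then s i == j else false.
have inj_q : injective (quaternary \o graph).
  move=> s t /quaternary_inj st; apply/funext => i.
  have := congr1 (@^~ (pickle (i, s i))) st.
  by rewrite /graph pickleK eqxx => /esym/eqP ->.
apply/(@pcard_injP _ R); exists (quaternary \o graph) => s t _ _.
exact: inj_q.
Qed.

End Continuum.

Section Counting.
Variable G : zmodType.

(** The multiples of the terms of such a chain form a divisible set, as [d n] is
    [d (n + m)] times a product of [m] consecutive integers, which [m] divides. *)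
Lemma divisible_part_chain (d : nat -> G) :
  (forall n, d n = d n.+1 *+ n.+1) -> divisible_part G (d 0%N).
Proof.
move=> dS; exists [set z | exists n j, z = d n *+ j]; last by exists 0%N, 1%N.
have dD n m : d n = d (n + m)%N *+ (n + m) ^_ m.
  elim: m => [|m ->]; first by rewrite addn0.
  by rewrite [in LHS]dS addnS ffactSS mulrnA.
move=> _ m [n [j ->]] m0.
have /dvdnP[a aE] : (m %| (n + m) ^_ m)%N.
  by rewrite -bin_ffact dvdn_mull// dvdn_fact// m0 leqnn.
exists (d (n + m)%N *+ (a * j)%N); first by exists (n + m)%N, (a * j)%N.
by rewrite [in RHS](dD n m) aE -!mulrnA mulnAC.
Qed.

(** Write [g = c 0 + r 1 *+ 1], [r 1 = c 1 + r 2 *+ 2], and so on, where [c n]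
    runs over a countable set of representatives.  If two elements have the same
    digits [c n], the differences of their remainders [r n] form a chain as in
    [divisible_part_chain], so the elements agree modulo the divisible part; one
    more natural number then separates them. *)
Lemma embeds_in_sequences :
  countable (divisible_part G) ->
  (forall n, (0 < n)%N -> countable_mod [set: G] n) ->
  exists F : G -> nat -> nat, injective F.
Proof.
move=> /countable_injP[fD fD_inj] cmod.
have /choice[C CP] n : exists C : set G, countable C /\
    forall x, exists c h, C c /\ x = c + h *+ n.+1.
  by have [C cC CP] := cmod n.+1 isT; exists C; split=> // x; exact: CP.
have /choice[f f_inj] n : exists f : G -> nat, {in C n &, injective f}.
  by have [/countable_injP[f f_inj] _] := CP n; exists f.
have /choice[D DP] (nx : nat * G) : exists ch : G * G,
    C nx.1 ch.1 /\ nx.2 = ch.1 + ch.2 *+ nx.1.+1.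
  by have [_ /(_ nx.2)[c [h ch]]] := CP nx.1; exists (c, h).
pose fix r (g : G) n := if n is n'.+1 then (D (n', r g n')).2 else g.
pose code g n := f n (D (n, r g n)).1.
have code_eq g h : code g = code h -> divisible_part G (g - h).
  move=> gh; apply: (@divisible_part_chain (fun n => r g n - r h n)) => n.
  have [/= Cg gE] := DP (n, r g n); have [/= Ch hE] := DP (n, r h n).
  have := congr1 (@^~ n) gh => /f_inj; rewrite !inE => /(_ Cg Ch) cE.
  by rewrite [in LHS]gE [in LHS]hE cE mulrnBl opprD addrACA subrr add0r.
have /choice[rep repP] s : exists g, (exists h, code h = s) -> code g = s.
  have [[h hs]|nos] := pselect (exists h, code h = s); first by exists h.
  by exists 0 => /nos.
exists (fun g n => if n is n'.+1 then code g n' else fD (g - rep (code g))).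
move=> g h gh.
have codeE : code g = code h.
  by apply/funext => n; exact: (congr1 (@^~ n.+1) gh).
have := congr1 (@^~ 0%N) gh; rewrite /= codeE => /fD_inj; rewrite !inE => eqD.
have crep : code (rep (code h)) = code h by apply: repP; exists h.
by apply: (addIr (- rep (code h))); apply: eqD; apply: code_eq; rewrite crep.
Qed.

End Counting.

Lemma no_nonsingular_string (R : realType) (G : zmodType) :
  ns R G = 0%E -> ~ has_nonsingular_string G.
Proof.
move=> ns0 [phi [x xP]].
have : (counting [set x] <= ns R G)%E.
  apply: (@le_trans _ _ (ns_end R phi)); last first.
    by apply: ereal_sup_ubound; exists phi.
  apply: ereal_sup_ubound; exists [set x] => //; split=> [_ ->//|].
  by move=> y z -> ->.
rewrite ns0 /counting asboolT; last exact: finite_set1.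
by rewrite fset_set1 finmap.cardfs1 lee_fin ler10.
Qed.

Theorem theorem3p7 (R : realType) (G : zmodType) (htors : torsion G)
    (hns : ns R G = 0%E) : ([set: G] #<= [set: R])%card.
Proof.
have noS := no_nonsingular_string hns.
have [||F F_inj] := @embeds_in_sequences G.
- exact: countable_divisible_part.
- by move=> n; exact: countable_mod_multiples.
apply: card_le_trans (sequences_le_continuum R).
by apply/(@pcard_injP _ (nat -> nat)); exists F => g h _ _; exact: F_inj.
Qed.
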